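(* Suppose each $f_i$ is strongly convex with constant $\mu_i>0$, $i=1,\dots,m$; let $\mu=\min_i\mu_i$ and $L_h=(1/\mu)(2+2\cos(\pi/m))$. Let $\{\boldsymbol{\lambda}^{(k)}\}_{k\ge0}$ be generated by the inexact dual algorithm with distortions satisfying $\|\mathbf{r}_i^{(k)}\|\le\varepsilon_i$ for all $i,k$ and with stepsizes satisfying $0<\gamma_k\le1/L_h$ for all $k\ge0$. Then, with $h=-g$, for every $k\ge0$, $$h(\boldsymbol{\lambda}^{(k+1)})\le h(\boldsymbol{\lambda}^{(k)})-\frac{\gamma_k}{2}\|\nabla h(\boldsymbol{\lambda}^{(k)})\|^2+\frac{\gamma_k}{2}\epsilon^2 .$$
   Context: Let $m\ge2$, $n\ge1$ be integers, $\mathcal{Y}\subseteq\mathbb{R}^n$ a nonempty closed convex set, and $f_i:\mathbb{R}^n\to\mathbb{R}$, $i=1,\dots,m$, strictly convex closed functions. For $\mathbf{y}=(\mathbf{y}_1,\dots,\mathbf{y}_m)\in(\mathbb{R}^n)^m=\mathbb{R}^{nm}$ put $f(\mathbf{y})=\sum_{i=1}^m f_i(\mathbf{y}_i)$, let $\bar{\mathcal{Y}}=\mathcal{Y}^m$, and $\mathbf{A}\mathbf{y}=(\mathbf{y}_1-\mathbf{y}_2,\dots,\mathbf{y}_{m-1}-\mathbf{y}_m)\in\mathbb{R}^{n(m-1)}$. The dual function is $g(\boldsymbol{\lambda})=\inf_{\mathbf{y}\in\bar{\mathcal{Y}}}\big[f(\mathbf{y})+\boldsymbol{\lambda}^{T}\mathbf{A}\mathbf{y}\big]$,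 $\boldsymbol{\lambda}\in\mathbb{R}^{n(m-1)}$; when all $f_i$ are strongly convex, $g$ is differentiable. Inexact dual algorithm: start from any $\boldsymbol{\lambda}^{(0)}\in\mathbb{R}^{n(m-1)}$; for $k=0,1,2,\dots$ let $\mathbf{y}^{(k)}=\arg\min_{\mathbf{y}\in\bar{\mathcal{Y}}}\big[f(\mathbf{y})+(\boldsymbol{\lambda}^{(k)})^{T}\mathbf{A}\mathbf{y}\big]$, let $\hat{\mathbf{y}}_i^{(k)}=\mathbf{y}_i^{(k)}+\mathbf{r}_i^{(k)}$ where $\mathbf{r}_i^{(k)}\in\mathbb{R}^n$ are arbitrary distortions, let $\hat{\mathbf{d}}^{(k)}=\mathbf{A}\hat{\mathbf{y}}^{(k)}$, and set $\boldsymbol{\lambda}^{(k+1)}=\boldsymbol{\lambda}^{(k)}+\gamma_k\hat{\mathbf{d}}^{(k)}$. The distortions are bounded by constants: $\|\mathbf{r}_i^{(k)}\|\le\varepsilon_i$ for all $i$ and $k$, and $\epsilon:=\sqrt{\sum_{i=1}^{m-1}(\varepsilon_i+\varepsilon_{i+1})^2}$. Norms are Euclidean. A function $\varphi$ is strongly convex with constant $\sigma>0$ if $\varphi-\frac{\sigma}{2}\|\cdot\|^2$ is convex. *)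

(* Defs.v *)
From HB Require Import structures.
From mathcomp Require Import all_boot all_order all_algebra.
From mathcomp Require Import all_classical all_reals all_analysis.

Set Implicit Arguments.
Unset Strict Implicit.
Unset Printing Implicit Defensive.

Import Order.TTheory GRing.Theory Num.Theory.
Import numFieldNormedType.Exports.

Local Open Scope classical_set_scope.
Local Open Scope ring_scope.

(* A point (x_1, .., x_p) of (R^n)^p = R^(np) is the matrix 'M[R]_(p, n) whose
   i-th row is x_i. The norm `|x| carried by the library is the sup norm, so
   the Euclidean one is defined here; both induce the same topology. *)
Definition dot (R : realType) (p q : nat) (u v : 'M[R]_(p, q)) : R :=
  \sum_(i < p) \sum_(j < q) u i j * v i j.

Definition enorm (R : realType) (p q : nat) (u : 'M[R]_(p, q)) : R :=
  Num.sqrt (dot u u).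

Definition grad (R : realType) (p q : nat) (F : 'M[R]_(p, q) -> R)
    (x : 'M[R]_(p, q)) : 'M[R]_(p, q) :=
  \matrix_(i < p, j < q) 'D_(delta_mx i j) F x.

Definition strictly_convex (R : realType) (n : nat) (phi : 'rV[R]_n -> R) :=
  forall (x y : 'rV[R]_n) (t : R), x <> y -> 0 < t -> t < 1 ->
    phi (t *: x + (1 - t) *: y) < t * phi x + (1 - t) * phi y.

Definition strongly_convex (R : realType) (n : nat) (sigma : R)
    (phi : 'rV[R]_n -> R) :=
  0 < sigma /\
  convex_function setT (fun x : 'rV[R]_n => phi x - sigma / 2 * enorm x ^+ 2).

(* closed in the sense of convex analysis: the epigraph is a closed set *)
Definition closed_function (R : realType) (n : nat) (phi : 'rV[R]_n -> R) :=
  closed [set p : 'rV[R]_n * R | phi p.1 <= p.2].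

Definition is_argmin (R : realType) (T : Type) (D : set T) (F : T -> R)
    (x : T) := D x /\ forall z, D z -> F x <= F z.

Section Consecutive.
Variable m : nat.

Definition ord_here (i : 'I_m.-1) : 'I_m := widen_ord (leq_pred m) i.

Lemma ord_next_subproof (i : 'I_m.-1) : (i.+1 < m)%N.
Proof. by case: m i => [|m'] [i hi]. Qed.

Definition ord_next (i : 'I_m.-1) : 'I_m := Ordinal (ord_next_subproof i).

End Consecutive.

Section DualProblem.
Variables (R : realType) (m n : nat).

Definition Aop (y : 'M[R]_(m, n)) : 'M[R]_(m.-1, n) :=
  \matrix_(i < m.-1, j < n) (y (ord_here i) j - y (ord_next i) j).

Definition Ybar (Y : set 'rV[R]_n) : set 'M[R]_(m, n) :=
  [set y | forall i : 'I_m, Y (row i y)].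

Variables (Y : set 'rV[R]_n) (f : 'I_m -> 'rV[R]_n -> R).

Definition lagrangian (lambda : 'M[R]_(m.-1, n)) (y : 'M[R]_(m, n)) : R :=
  \sum_(i < m) f i (row i y) + dot lambda (Aop y).

(* Real-valued infimum: inf is 0 on sets unbounded below, which does not occur
   when every f i is strongly convex. *)
Definition dual_fun (lambda : 'M[R]_(m.-1, n)) : R :=
  inf [set lagrangian lambda y | y in Ybar Y].

Definition inexact_dual_algorithm (gamma : nat -> R)
    (r y : nat -> 'M[R]_(m, n)) (lambda : nat -> 'M[R]_(m.-1, n)) :=
  forall k : nat,
    is_argmin (Ybar Y) (lagrangian (lambda k)) (y k) /\
    lambda k.+1 = lambda k + gamma k *: Aop (y k + r k).

End DualProblem.

(* epsilon, with vareps i the bound on the i-th distortion *)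
Definition total_distortion (R : realType) (m : nat) (vareps : 'I_m -> R) : R :=
  Num.sqrt (\sum_(i < m.-1)
    (vareps (ord_here i) + vareps (ord_next i)) ^+ 2).

Definition min_const (R : realType) (m : nat) (hm : (0 < m)%N)
    (mu : 'I_m -> R) : R :=
  \big[Num.min/mu (Ordinal hm)]_(i < m) mu i.

Definition L_h (R : realType) (m : nat) (hm : (0 < m)%N)
    (mu : 'I_m -> R) : R :=
  (1 / min_const hm mu) * (2 + 2 * cos (pi / m%:R)).

(* Main.v *)
(* Strong convexity of the Lagrangian makes it grow quadratically away from its
   minimizer y^(k), so that perturbing lambda by d changes the dual function by
   <d, A y^(k)> up to an error at most |A^T d|^2 / (2 mu). Hence h has gradient
   - A y^(k) there, and, since |A|^2 <= 2 + 2 cos(pi/m), it satisfies the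
   descent inequality with constant L_h. Only minimizers supplied by the
   algorithm are involved. Taking d = gamma (A y + A r) and using
   gamma L_h <= 1, the cross terms cancel:
   - <A y + A r, A y> + |A y + A r|^2 / 2 = (|A r|^2 - |A y|^2) / 2. *)

Require Import Defs.
From HB Require Import structures.
From mathcomp Require Import all_boot all_order all_algebra.
From mathcomp Require Import all_classical all_reals all_analysis.
From mathcomp Require Import ring lra.

Set Implicit Arguments.
Unset Strict Implicit.
Unset Printing Implicit Defensive.

Import Order.TTheory GRing.Theory Num.Theory.
Import numFieldNormedType.Exports.

Local Open Scope classical_set_scope.
Local Open Scope ring_scope.

(** * The Euclidean inner product on matrices *)

Section Dot.
Variables (R : realType) (p q : nat).
Implicit Types (u v w : 'M[R]_(p, q)) (a : R).

Lemma dotC u v : dot u v = dot v u.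
Proof. by apply: eq_bigr => i _; apply: eq_bigr => j _; rewrite mulrC. Qed.

Lemma dotDl u v w : dot (u + v) w = dot u w + dot v w.
Proof.
rewrite /dot -big_split; apply: eq_bigr => i _ /=.
by rewrite -big_split; apply: eq_bigr => j _ /=; rewrite mxE mulrDl.
Qed.

Lemma dotZl a u v : dot (a *: u) v = a * dot u v.
Proof.
rewrite /dot mulr_sumr; apply: eq_bigr => i _.
by rewrite mulr_sumr; apply: eq_bigr => j _; rewrite mxE mulrA.
Qed.

Lemma dotDr u v w : dot u (v + w) = dot u v + dot u w.
Proof. by rewrite !(dotC u) dotDl. Qed.

Lemma dotZr a u v : dot u (a *: v) = a * dot u v.
Proof. by rewrite !(dotC u) dotZl. Qed.

Lemma dotNl u v : dot (- u) v = - dot u v.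
Proof. by rewrite -scaleN1r dotZl mulN1r. Qed.

Lemma dotNr u v : dot u (- v) = - dot u v.
Proof. by rewrite !(dotC u) dotNl. Qed.

Definition dotE := (dotDl, dotDr, dotNl, dotNr, dotZl, dotZr).

Lemma dot_ge0 u : 0 <= dot u u.
Proof. by do 2!apply: sumr_ge0 => ? _; rewrite -expr2 sqr_ge0. Qed.

Lemma enorm_sqr u : enorm u ^+ 2 = dot u u.
Proof. by rewrite sqr_sqrtr ?dot_ge0. Qed.

Lemma dot_eq0 u : dot u u = 0 -> u = 0.
Proof.
move=> u0; apply/matrixP => i j; rewrite mxE; apply/eqP.
have ge0 k : true -> 0 <= \sum_(l < q) u k l * u k l.
  by move=> _; apply: sumr_ge0 => l _; rewrite -expr2 sqr_ge0.
have ge0i l : true -> 0 <= u i l * u i l by rewrite -expr2 sqr_ge0.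
have := psumr_eq0P ge0i (psumr_eq0P ge0 u0 (i := i) isT) (i := j) isT.
by move/eqP; rewrite mulf_eq0 orbb.
Qed.

Lemma dot_deltal i j u : dot (delta_mx i j) u = u i j.
Proof.
rewrite /dot (bigD1 i)//= (bigD1 j)//= !mxE !eqxx mul1r.
rewrite big1 ?addr0 => [|l /negPf lj]; last by rewrite mxE lj andbF mul0r.
rewrite big1 ?addr0// => k /negPf ki; apply: big1 => l _.
by rewrite mxE ki mul0r.
Qed.

(** Squared triangle inequality, with Cauchy-Schwarz proved along the way in the form
    [- dot u v <= a * b]. That argument divides by [a * b], so zero bounds are treated apart. *)
Lemma dotB_le u v a b : enorm u <= a -> enorm v <= b ->
  dot (u - v) (u - v) <= (a + b) ^+ 2.
Proof.
move=> ua vb.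
have a0 : 0 <= a by rewrite (le_trans _ ua)// sqrtr_ge0.
have b0 : 0 <= b by rewrite (le_trans _ vb)// sqrtr_ge0.
have uu : dot u u <= a ^+ 2 by rewrite -enorm_sqr ler_sqr ?nnegrE ?sqrtr_ge0.
have vv : dot v v <= b ^+ 2 by rewrite -enorm_sqr ler_sqr ?nnegrE ?sqrtr_ge0.
rewrite !dotE (dotC v u).
suff : - dot u v <= a * b by move=> ?; nra.
have [a_eq0|a_neq0] := eqVneq a 0.
  have -> : u = 0.
    apply: dot_eq0; apply/eqP; rewrite eq_le dot_ge0 andbT.
    by rewrite (le_trans uu)// a_eq0 expr0n.
  by rewrite -(scale0r 0) dotZl mul0r oppr0 mulr_ge0.
have [b_eq0|b_neq0] := eqVneq b 0.
  have -> : v = 0.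
    apply: dot_eq0; apply/eqP; rewrite eq_le dot_ge0 andbT.
    by rewrite (le_trans vv)// b_eq0 expr0n.
  by rewrite -(scale0r 0) dotZr mul0r oppr0 mulr_ge0.
have ab0 : 0 < a * b by rewrite mulr_gt0// lt_neqAle eq_sym ?a_neq0 ?b_neq0.
(* Expanding this square gives [- 2ab<u,v> <= b^2 |u|^2 + a^2 |v|^2], which is at most
   [2 a^2 b^2]. *)
have := dot_ge0 (b *: u + a *: v); rewrite !dotE (dotC v u) => h.
rewrite -(ler_pM2l ab0).
have := ler_wpM2l (sqr_ge0 b) uu; have := ler_wpM2l (sqr_ge0 a) vv.
by nra.
Qed.

End Dot.

Lemma dot_rows (R : realType) (p q : nat) (u v : 'M[R]_(p, q)) :
  dot u v = \sum_(i < p) dot (row i u) (row i v).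
Proof.
apply: eq_bigr => i _; rewrite /dot big_ord1.
by apply: eq_bigr => j _; rewrite !mxE.
Qed.

(** * Gradients from quadratic remainders, and strong convexity *)

(** Along a basis vector, the difference quotient with step [s] is within [C |s|] of the entry of
    [G], so the limit defining the partial derivative exists and equals that entry. *)
Lemma grad_quadratic_bound (R : realType) (p q : nat) (F : 'M[R]_(p, q) -> R)
    (x G : 'M[R]_(p, q)) (C : R) :
  (forall d, `|F (x + d) - F x - dot d G| <= C * dot d d) -> grad F x = G.
Proof.
move=> FG; apply/matrixP => i j; rewrite mxE; apply: cvg_lim => //.
set v := delta_mx i j.
have C0 : 0 <= C.
  have := le_trans (normr_ge0 _) (FG v).
  by rewrite dot_deltal mxE !eqxx mulr1.
apply/cvgrPdist_le => e e0.
near=> s.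
have s0 : s != 0 by near: s; exact: nbhs_dnbhs_neq.
(* [C + 1] is positive even when [C = 0], so it can be divided by. *)
have sC : `|s| * (C + 1) <= e.
  rewrite -ler_pdivlMr; last lra.
  near: s; apply: dnbhs0_le; apply: divr_gt0 => //; lra.
have := FG (s *: v); rewrite !dotZl dotZr dot_deltal dot_deltal mxE !eqxx mulr1.
rewrite /= /shift (addrC x) distrC => h.
have ns0 : 0 < `|s| by rewrite normr_gt0.
rewrite -(ler_pM2l ns0) -normrM.
have -> : s * (G i j - s^-1 *: (F (s *: v + x) - F x)) =
   s * G i j - (F (s *: v + x) - F x).
  by rewrite mulrBr -[s^-1 *: _]/(s^-1 * _) mulVKf.
apply: le_trans h _.
have -> : s * s = `|s| * `|s| by rewrite -normrM ger0_norm// -expr2 sqr_ge0.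
nra.
Unshelve. all: by end_near. Qed.

(** Follows from the identity [t|x|^2 + (1-t)|y|^2 - |tx + (1-t)y|^2 = t(1-t)|x-y|^2]. *)
Lemma strongly_convex_jensen (R : realType) (n : nat) (sigma : R)
    (phi : 'rV[R]_n -> R) (x y : 'rV[R]_n) (t : R) :
  strongly_convex sigma phi -> 0 <= t -> t <= 1 ->
  phi (t *: x + (1 - t) *: y)
    + sigma / 2 * (t * (1 - t)) * dot (x - y) (x - y)
  <= t * phi x + (1 - t) * phi y.
Proof.
move=> [_ cvx] t0 t1.
have := cvx (Itv01 t0 t1) x y (in_setT _) (in_setT _).
rewrite convRE /= -[conv _ _ _]/(t *: x + (1 - t) *: y) /unstable.onem !enorm_sqr.
rewrite !dotE (dotC y x) => h.
by nra.
Qed.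

(** * The largest eigenvalue of the path Laplacian *)

Section PathSpectrum.
Variable R : realType.

(* The vector (-1)^k sin((2k+1) theta), with theta = pi/(2m), is the top
   eigenvector of the path Laplacian on m vertices; its absolute values weight
   the AM-GM inequality applied to each cross term. *)
Lemma path_energy_partial (theta : R) (k : nat) (w : nat -> R) :
  (forall i, (i <= k)%N -> 0 < sin ((2 * i%:R + 1) * theta)) ->
  \sum_(i < k) (w i - w i.+1) ^+ 2 <=
  (2 + 2 * cos (2 * theta)) * \sum_(i < k) w i ^+ 2 +
  (1 + sin ((2 * k%:R - 1) * theta) / sin ((2 * k%:R + 1) * theta)) * w k ^+ 2.
Proof.
elim: k => [|k IH] s_gt0.
  (* For [k = 0] the ratio of sines is -1, so the boundary coefficient vanishes. *)
  rewrite !big_ord0 !mulr0 !add0r mulN1r mul1r sinN.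
  have := s_gt0 0%N isT; rewrite mulr0 add0r mul1r => /lt0r_neq0 s0.
  by rewrite mulNr divff// subrr mul0r.
have sk := s_gt0 k (leqnSn k); have sk1 := s_gt0 k.+1 (leqnn _).
rewrite !big_ord_recr /= mulrDr.
have {}IH := IH (fun i ik => s_gt0 i (leqW ik)).
have E : (2 * k.+1%:R - 1) * theta = (2 * k%:R + 1) * theta.
  by rewrite -(natr1 k); ring.
rewrite E.
(* The eigenvector equation at an interior vertex, as a three-term recurrence. *)
have rec : sin ((2 * k.+1%:R + 1) * theta) =
    2 * cos (2 * theta) * sin ((2 * k%:R + 1) * theta)
    - sin ((2 * k%:R - 1) * theta).
  have -> : (2 * k.+1%:R + 1) * theta = (2 * k%:R + 1) * theta + 2 * theta.
    by rewrite -(natr1 k); ring.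
  have -> : (2 * k%:R - 1) * theta = (2 * k%:R + 1) * theta - 2 * theta by ring.
  by rewrite sinB sinD; ring.
move: sk sk1 rec IH.
set a := sin _; set b := sin _; set c := cos _; set d := sin _.
move=> a0 b0 rec IH.
suff : (w k - w k.+1) ^+ 2 + (1 + d / a) * w k ^+ 2 <=
    (2 + 2 * c) * w k ^+ 2 + (1 + a / b) * w k.+1 ^+ 2 by lra.
rewrite -subr_ge0.
(* Eliminating [d] by the recurrence turns the gap into a perfect square over [a * b]. *)
have -> : (2 + 2 * c) * w k ^+ 2 + (1 + a / b) * w k.+1 ^+ 2 -
    ((w k - w k.+1) ^+ 2 + (1 + d / a) * w k ^+ 2) =
    (b * w k + a * w k.+1) ^+ 2 / (a * b).
  have -> : d = 2 * c * a - b by lra.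
  by field; rewrite !gt_eqF.
by rewrite divr_ge0 ?sqr_ge0// mulr_ge0// ltW.
Qed.

(** Here [m] counts edges, so there are [m.+1] vertices. It remains to check that the boundary
    coefficient of the partial bound at the last vertex is at most the eigenvalue. *)
Lemma path_energy_le (m : nat) (w : nat -> R) :
  \sum_(i < m) (w i - w i.+1) ^+ 2 <=
  (2 + 2 * cos (pi / m.+1%:R)) * \sum_(i < m.+1) w i ^+ 2.
Proof.
set theta : R := pi / m.+1%:R / 2.
have m0 : 0 < m.+1%:R :> R by rewrite ltr0n.
have -> : pi / m.+1%:R = 2 * theta by rewrite /theta; field; rewrite gt_eqF.
have thpi : pi = 2 * m.+1%:R * theta by rewrite /theta; field; rewrite gt_eqF.
have th0 : 0 < theta by rewrite !divr_gt0 ?pi_gt0.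
have s_gt0 i : (i <= m)%N -> 0 < sin ((2 * i%:R + 1) * theta).
  move=> im; apply: sin_gt0_pi; apply/andP; split.
    by rewrite mulr_gt0// ltr_wpDl// mulr_ge0.
  rewrite thpi ltr_pM2r// -(natr1 m).
  have : i%:R <= m%:R :> R by rewrite ler_nat.
  lra.
rewrite big_ord_recr /= mulrDr.
apply: le_trans (path_energy_partial w s_gt0) _.
rewrite lerD2l ler_wpM2r ?sqr_ge0//.
have sm := s_gt0 m (leqnn m).
(* Since [(2m+2) theta = pi], the sine is odd about that angle. This makes the ratio of sines
   [1 + 2 cos(2 theta)], so the coefficient equals the eigenvalue. *)
have refl : sin ((2 * m%:R + 1) * theta) =
    - sin ((2 * m%:R + 1) * theta + 2 * theta).
  have -> : (2 * m%:R + 1) * theta + 2 * theta =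
      - ((2 * m%:R + 1) * theta) + pi + pi.
    by rewrite thpi -(natr1 m); ring.
  by rewrite !sinDpi sinN !opprK.
have -> : (2 * m%:R - 1) * theta = (2 * m%:R + 1) * theta - 2 * theta by ring.
rewrite sinD in refl; rewrite sinB; move: sm refl.
set a := sin _; set c := cos (2 * theta).
set b := cos _; set d := sin _ => a0 refl.
have -> : a * c - b * d = a * (1 + 2 * c) by lra.
by rewrite mulrAC divff ?gt_eqF// mul1r; lra.
Qed.

End PathSpectrum.

(** * The difference operator and quadratic bounds on the dual function *)

Section DualSmoothness.
Variables (R : realType) (m n : nat).
Implicit Types (y z w : 'M[R]_(m, n)) (l d : 'M[R]_(m.-1, n)).

Lemma AopD y z : Aop (y + z) = Aop y + Aop z.
Proof. by apply/matrixP => i j; rewrite !mxE; ring. Qed.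

Lemma AopZ a y : Aop (a *: y) = a *: Aop y.
Proof. by apply/matrixP => i j; rewrite !mxE; ring. Qed.

Lemma AopB y z : Aop (y - z) = Aop y - Aop z.
Proof. by rewrite -scaleN1r AopD AopZ scaleN1r. Qed.

Lemma row_Aop i y :
  row i (Aop y) = row (ord_here i) y - row (ord_next i) y.
Proof. by apply/rowP => j; rewrite !mxE. Qed.

(** The columns decouple, and each is a function on the vertices of a path whose edges carry the
    entries of [Aop y]. *)
Lemma dot_Aop_le y :
  dot (Aop y) (Aop y) <= (2 + 2 * cos (pi / m%:R)) * dot y y.
Proof.
rewrite /dot exchange_big [in leRHS]exchange_big mulr_sumr /=.
apply: ler_sum => j _.
case: m y => [|M] y; first by rewrite !big_ord0 mulr0.
have := path_energy_le M (fun k => y (inord k) j).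
congr (_ <= _ * _); apply: eq_bigr => i _; rewrite ?mxE expr2.
  have -> : @ord_here M.+1 i = inord i.
    by apply: val_inj; rewrite /= inordK// (ltn_trans (ltn_ord i)).
  have -> // : @ord_next M.+1 i = inord i.+1.
  by apply: val_inj; rewrite /= inordK// ltnS.
by rewrite inord_val.
Qed.

Variables (Y : set 'rV[R]_n) (f : 'I_m -> 'rV[R]_n -> R).

Lemma Ybar_convex y z (t : R) : convex_set Y -> 0 <= t -> t <= 1 ->
  Ybar Y y -> Ybar Y z -> Ybar Y (t *: y + (1 - t) *: z).
Proof.
move=> cY t0 t1 Yy Yz i; rewrite linearD !linearZ /=.
have := cY (row i y) (row i z) (Itv01 t0 t1) (mem_set (Yy i)) (mem_set (Yz i)).
by rewrite inE.
Qed.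

Lemma lagrangianD l d y :
  lagrangian f (l + d) y = lagrangian f l y + dot d (Aop y).
Proof. by rewrite /lagrangian dotDl addrA. Qed.

(** The coupling term is linear in [y], so the row-wise inequalities add up once each modulus is
    lowered to [sigma]. *)
Lemma lagrangian_jensen (sigma : R) l y z (t : R) :
  (forall i, exists2 s, sigma <= s & strongly_convex s (f i)) ->
  0 <= t -> t <= 1 ->
  lagrangian f l (t *: z + (1 - t) *: y)
    + sigma / 2 * (t * (1 - t)) * dot (z - y) (z - y)
  <= t * lagrangian f l z + (1 - t) * lagrangian f l y.
Proof.
move=> sf t0 t1; rewrite /lagrangian (dot_rows (z - y)) AopD !AopZ !dotE.
rewrite !mulrDr [leLHS]addrAC [leRHS]addrACA lerD2r.
rewrite !mulr_sumr -!big_split /=; apply: ler_sum => i _.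
have [s sigs scvx] := sf i.
rewrite !(linearD, linearN, linearZ) /=.
apply: le_trans (strongly_convex_jensen (row i z) (row i y) scvx t0 t1).
rewrite lerD2l ler_wpM2r ?dot_ge0//.
have : 0 <= (s - sigma) * (t * (1 - t)) by rewrite !mulr_ge0 ?subr_ge0.
lra.
Qed.

(* Divide Jensen's inequality between y and z by t, and let t tend to 0. *)
Lemma argmin_quadratic_growth (sigma : R) l y z :
  convex_set Y -> 0 < sigma ->
  (forall i, exists2 s, sigma <= s & strongly_convex s (f i)) ->
  is_argmin (Ybar Y) (lagrangian f l) y -> Ybar Y z ->
  lagrangian f l y + sigma / 2 * dot (z - y) (z - y) <= lagrangian f l z.
Proof.
move=> cY sigma0 sf [Yy ymin] Yz; rewrite -lerBrDl.
set D := lagrangian f l z - _; set Q := sigma / 2 * _.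
have Q0 : 0 <= Q by rewrite mulr_ge0 ?dot_ge0// divr_ge0 ?ltW.
have DQ t : 0 < t -> t <= 1 -> (1 - t) * Q <= D.
  move=> t0 t1.
  have := lagrangian_jensen l y z sf (ltW t0) t1.
  have := ymin _ (Ybar_convex cY (ltW t0) t1 Yz Yy).
  move=> h1 h2; rewrite -(ler_pM2l t0) /D /Q; nra.
have D0 : 0 <= D by have := DQ 1 ltr01 (lexx _); rewrite subrr mul0r.
rewrite leNgt; apply/negP => DltQ.
(* For this [t], [(1 - t) * Q] is the midpoint of [D] and [Q], hence exceeds [D]. *)
have t0 : 0 < (Q - D) / (2 * Q) by apply: divr_gt0; lra.
have tQ : (Q - D) / (2 * Q) * Q = (Q - D) / 2 by field; rewrite gt_eqF//; lra.
have t1 : (Q - D) / (2 * Q) <= 1 by rewrite ler_pdivrMr; lra.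
by have := DQ _ t0 t1; rewrite mulrBl tQ; lra.
Qed.

Lemma dual_fun_argmin l y :
  is_argmin (Ybar Y) (lagrangian f l) y -> dual_fun Y f l = lagrangian f l y.
Proof.
move=> [Yy ymin]; apply/eqP; rewrite eq_le; apply/andP; split.
  apply: ge_inf; last by exists y.
  by exists (lagrangian f l y) => _ [z Yz <-]; exact: ymin.
apply: lb_le_inf; first by exists (lagrangian f l y), y.
by move=> _ [z Yz <-]; exact: ymin.
Qed.

(** Testing the perturbed infimum at [y] gives the upper bound. For the lower one, quadratic growth
    at any feasible [z] absorbs [dot d (Aop (z - y))] by Young's inequality and the spectral
    bound. *)
Lemma dual_fun_smooth (sigma : R) l d y :
  convex_set Y -> 0 < sigma -> 0 < 2 + 2 * cos (pi / m%:R) :> R ->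
  (forall i, exists2 s, sigma <= s & strongly_convex s (f i)) ->
  is_argmin (Ybar Y) (lagrangian f l) y ->
  - ((2 + 2 * cos (pi / m%:R)) / sigma / 2 * dot d d) <=
  dual_fun Y f (l + d) - dual_fun Y f l - dot d (Aop y) <= 0.
Proof.
move=> cY sigma0; set c := 2 + _ => c0 sf ymin.
set B := c / sigma / 2 * _; rewrite (dual_fun_argmin ymin).
have lb z : Ybar Y z ->
    lagrangian f l y + dot d (Aop y) - B <= lagrangian f (l + d) z.
  move=> Yz; rewrite lagrangianD.
  have growth := argmin_quadratic_growth cY sigma0 sf ymin Yz.
  have spec := dot_Aop_le (z - y); rewrite -/c AopB in spec.
  have -> : dot d (Aop z) = dot d (Aop y) + dot d (Aop z - Aop y).
    by rewrite dotDr dotNr addrCA subrr addr0.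
  move: (Aop z - Aop y) spec => e spec.
  (* [0 <= (sigma / (2 c)) |(c / sigma) d + e|^2] *)
  suff : - B - sigma / 2 * dot (z - y) (z - y) <= dot d e by lra.
  have k0 : 0 < sigma / (2 * c) by apply: divr_gt0 => //; lra.
  have := mulr_ge0 (ltW k0) (dot_ge0 ((c / sigma) *: d + e)).
  have := ler_wpM2l (ltW k0) spec.
  have -> : sigma / (2 * c) * (c * dot (z - y) (z - y)) =
    sigma / 2 * dot (z - y) (z - y) by field; rewrite gt_eqF.
  have -> : sigma / (2 * c) * dot ((c / sigma) *: d + e) ((c / sigma) *: d + e)
      = B + dot d e + sigma / (2 * c) * dot e e.
    by rewrite /B !dotE (dotC e d); field; rewrite !gt_eqF.
  lra.
case: (ymin) => Yy _.
(* This also shows boundedness below, so [inf] at [l + d] does not take its default value. *)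
have lbset : lbound [set lagrangian f (l + d) z | z in Ybar Y]
    (lagrangian f l y + dot d (Aop y) - B) by move=> _ [z Yz <-]; exact: lb.
have : lagrangian f l y + dot d (Aop y) - B <= dual_fun Y f (l + d).
  by apply: lb_le_inf => //; exists (lagrangian f (l + d) y), y.
have : dual_fun Y f (l + d) <= lagrangian f l y + dot d (Aop y).
  rewrite -lagrangianD; apply: ge_inf; last by exists y.
  by eexists; exact: lbset.
by move=> h1 h2; apply/andP; split; lra.
Qed.

Lemma dot_Aop_distortion w (vareps : 'I_m -> R) :
  (forall i, enorm (row i w) <= vareps i) ->
  dot (Aop w) (Aop w) <= total_distortion vareps ^+ 2.
Proof.
move=> wle; rewrite sqr_sqrtr; last by apply: sumr_ge0 => i _; exact: sqr_ge0.
rewrite dot_rows; apply: ler_sum => i _; rewrite row_Aop; exact: dotB_le.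
Qed.

End DualSmoothness.

(** * Descent along one inexact dual step *)

Theorem lemma1 (R : realType) (m n : nat) (hm : (2 <= m)%N) (hn : (1 <= n)%N)
  (Y : set 'rV[R]_n) (Y_nonempty : Y !=set0) (Y_closed : closed Y)
  (Y_convex : convex_set Y)
  (f : 'I_m -> 'rV[R]_n -> R)
  (f_strictly_convex : forall i : 'I_m, strictly_convex (f i))
  (f_closed : forall i : 'I_m, closed_function (f i))
  (mu : 'I_m -> R)
  (f_strongly_convex : forall i : 'I_m, strongly_convex (mu i) (f i))
  (gamma : nat -> R)
  (r y : nat -> 'M[R]_(m, n))
  (lambda : nat -> 'M[R]_(m.-1, n))
  (algo : inexact_dual_algorithm Y f gamma r y lambda)
  (vareps : 'I_m -> R)
  (r_bounded : forall (i : 'I_m) (k : nat), enorm (row i (r k)) <= vareps i)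
  (gamma_bounded : forall k : nat, 0 < gamma k <= 1 / L_h (ltnW hm) mu) :
  let h := fun l : 'M[R]_(m.-1, n) => - dual_fun Y f l in
  forall k : nat,
    h (lambda k.+1) <= h (lambda k)
      - gamma k / 2 * enorm (grad h (lambda k)) ^+ 2
      + gamma k / 2 * total_distortion vareps ^+ 2.
Proof.
move=> h k.
set mn := min_const (ltnW hm) mu; set c : R := 2 + 2 * cos (pi / m%:R).
have mu0 i : 0 < mu i by have [] := f_strongly_convex i.
have mn0 : 0 < mn by exact: lt_bigmin.
have [g0 gL] := andP (gamma_bounded k).
(* Positivity of [L_h], and then of [c], is read off from [0 < gamma k <= 1 / L_h]. *)
have L0 : 0 < L_h (ltnW hm) mu.
  by rewrite -invr_gt0 -(div1r (L_h _ _)) (lt_le_trans g0).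
have LE : L_h (ltnW hm) mu = c / mn by rewrite /L_h -/mn -/c div1r mulrC.
have c0 : 0 < c by rewrite LE pmulr_lgt0 ?invr_gt0 in L0.
have sf i : exists2 s, mn <= s & strongly_convex s (f i).
  by exists (mu i); [exact: bigmin_le|].
have [ymin ->] := algo k.
have smooth d := dual_fun_smooth d Y_convex mn0 c0 sf ymin.
have gradE : grad h (lambda k) = - Aop (y k).
  apply: (@grad_quadratic_bound _ _ _ _ _ _ (c / mn / 2)) => d.
  have /andP[] := smooth d; rewrite -/c /h dotNr => ? ?.
  rewrite ger0_norm; lra.
rewrite gradE enorm_sqr AopD /h.
have := smooth (gamma k *: (Aop (y k) + Aop (r k))) => /andP[+ _].
have := dot_Aop_distortion (fun i => r_bounded i k).
rewrite -/c -LE !dotE (dotC (Aop (r k))).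
set dd := dot (Aop (y k)) (Aop (y k)); set ee := dot (Aop (r k)) (Aop (r k)).
set de := dot (Aop (y k)) (Aop (r k)); set L := L_h _ _ => eeps h1.
have Lg : L * gamma k <= 1.
  by rewrite mulrC -(ler_pdivlMr _ _ L0).
have n0 : 0 <= dd + de + (de + ee).
  have := dot_ge0 (Aop (y k) + Aop (r k)).
  by rewrite !dotE (dotC (Aop (r k))).
(* Half of this replaces the coefficient [L * gamma k ^+ 2 / 2] of the squared step direction in
   [h1] by [gamma k / 2]. Half of [h3] then bounds the remaining [ee]. *)
have h2 : gamma k * ((1 - L * gamma k) * (dd + de + (de + ee))) >= 0.
  by rewrite !mulr_ge0 ?subr_ge0// ltW.
have h3 : gamma k * ee <= gamma k * total_distortion vareps ^+ 2.
  by rewrite ler_wpM2l// ltW.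
nra.
Qed.
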